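(* Let $(u_h,q_h)(\cdot,t)\in V_h^k\times V_h^k$ be the solution of the semi-discrete DG scheme $$(u_{ht},\phi)=-A(q_h,\phi),\qquad (q_h,\psi)=A(u_h,\psi)\qquad\text{for all }\phi,\psi\in V_h^k,$$ for the problem $u_t=-u_{xxxx}$ on $[a,b]$ with periodic boundary conditions. Then $$\frac12\frac{d}{dt}\int_a^b u_h^2\,dx=-\int_a^b q_h^2\,dx\le 0 .$$
   Context: Mesh: $[a,b]$ is partitioned into cells $I_j=[x_{j-1/2},x_{j+1/2}]$, $j=1,\dots,N$, with $x_{1/2}=a$, $x_{N+1/2}=b$. $V_h^k=\{v\in L^2([a,b]): v|_{I_j}\in P^k(I_j),\ j=1,\dots,N\}$, where $P^k(I_j)$ is the set of polynomials of degree at most $k$ on $I_j$. At $x_{j+1/2}$: $v^\pm$ are the right/left one-sided limits, $\{v\}=(v^-+v^+)/2$, $[v]=v^+-v^-$. Periodicity convention: at $x_{N+1/2}$ one takes $v^+_{N+1/2}:=v^+_{1/2}$. $(\cdot,\cdot)$ is the $L^2([a,b])$ inner product. The bilinear form is $$A(w,v)=\sum_{j=1}^N\int_{I_j}w_xv_x\,dx+\sum_{j=1}^N\big(\{w_x\}[v]+[w]\{v_x\}\big)_{j+1/2}.$$ *)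

(* Defs.v *)
From HB Require Import structures.
From mathcomp Require Export all_boot all_order all_algebra.
From mathcomp Require Export all_classical all_reals all_analysis.
Export Order.TTheory GRing.Theory Num.Theory numFieldNormedType.Exports.

Set Implicit Arguments.
Unset Strict Implicit.
Unset Printing Implicit Defensive.

Local Open Scope classical_set_scope.
Local Open Scope ring_scope.

(* A mesh of [a, b] is a sequence s with itv_partition a b s, i.e.
   a < s_0 < ... < s_(N-1) = b where N = size s.  With node 0 = a, the
   interface x_{j+1/2} is node a s j for 0 <= j <= N, and the cell I_j is
   [node a s j.-1, node a s j] for 1 <= j <= N. *)
Definition node (R : realType) (a : R) (s : seq R) (j : nat) : R :=
  (a :: s)`_j.

Definition inner (R : realType) (a b : R) (f g : R -> R) : R :=
  \int[@lebesgue_measure R]_(x in `[a, b]) (f x * g x).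

Definition L2 (R : realType) (a b : R) (v : R -> R) : Prop :=
  measurable_fun `[a, b] v /\
  (@lebesgue_measure R).-integrable `[a, b] (fun x => (v x ^+ 2)%:E).

(* Elements of V_h^k are L^2 classes, two-valued at the interfaces.  They are
   represented here by functions that agree with a polynomial of degree <= k
   on the interior of each cell; the values at the nodes (and outside [a, b])
   are arbitrary and are never used below, except on null sets. *)
Definition Vh (R : realType) (a b : R) (s : seq R) (k : nat) (v : R -> R) :
    Prop :=
  L2 a b v /\
  forall j : nat, (1 <= j <= size s)%N ->
    exists p : {poly R}, (size p <= k.+1)%N /\
      forall x, node a s j.-1 < x < node a s j -> v x = p.[x].

Definition minus_trace (R : realType) (a : R) (s : seq R) (v : R -> R)
    (j : nat) : R :=
  lim (v x @[x --> (node a s j)^'-]).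

(* Periodicity: at x_{N+1/2} the right limit is the one taken at x_{1/2}. *)
Definition plus_trace (R : realType) (a : R) (s : seq R) (v : R -> R)
    (j : nat) : R :=
  lim (v x @[x --> (node a s (if j == size s then 0%N else j))^'+]).

Definition avg (R : realType) (a : R) (s : seq R) (v : R -> R) (j : nat) : R :=
  (minus_trace a s v j + plus_trace a s v j) / 2.

Definition jump (R : realType) (a : R) (s : seq R) (v : R -> R) (j : nat) : R :=
  plus_trace a s v j - minus_trace a s v j.

Definition DG_form (R : realType) (a : R) (s : seq R) (w v : R -> R) : R :=
  \sum_(1 <= j < (size s).+1)
    (\int[@lebesgue_measure R]_(x in `[node a s j.-1, node a s j])
      (derive1 w x * derive1 v x))
  + \sum_(1 <= j < (size s).+1)
      (avg a s (derive1 w) j * jump a s v j + jump a s w j * avg a s (derive1 v) j).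

(* u t x and q t x are the values at time t and position x.  Time
   differentiability of u is only asked pointwise in the interior of the cells,
   where the representatives of elements of V_h^k are determined. *)
Definition DG_solution (R : realType) (a b : R) (s : seq R) (k : nat)
    (J : set R) (u q : R -> R -> R) : Prop :=
  forall t, J t ->
  [/\ Vh a b s k (u t) /\ Vh a b s k (q t),
      forall j x, (1 <= j <= size s)%N -> node a s j.-1 < x < node a s j ->
        derivable (fun r => u r x) t 1,
      forall phi, Vh a b s k phi ->
        inner a b (fun x => derive1 (fun r => u r x) t) phi
          = - DG_form a s (q t) phi
    & forall psi, Vh a b s k psi ->
        inner a b (q t) psi = DG_form a s (u t) psi].

(* Main.v *)
(* The form A is symmetric, so testing the first equation with u_h and the
   second one with q_h gives (u_ht, u_h) = - A(q_h, u_h) = - (q_h, q_h).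
   The derivative may be taken under the integral sign because time
   differentiability is only needed at the interpolation points: on a cell,
   u_h(r, x) is the sum of the u_h(r, y_i) L_i(x), with L_i the Lagrange basis
   at k + 1 points y_i inside the cell, so the cell energy is the quadratic form
   with constant coefficients \int L_i L_j in the numbers u_h(r, y_i). *)
Require Import Defs.
From mathcomp Require Import measurable_realfun qpoly.
Local Open Scope classical_set_scope.
Local Open Scope ring_scope.

Lemma DG_formC (R : realType) (a : R) (s : seq R) (w v : R -> R) :
  DG_form a s w v = DG_form a s v w.
Proof.
apply: (congr2 +%R); apply: eq_bigr => j _.
  by apply: eq_Rintegral => x _; exact: mulrC.
by rewrite addrC; apply: (congr2 +%R); exact: mulrC.
Qed.

(** * Integration of functions that are polynomial inside a cell *)

Section piecewise_polynomial.
Set Implicit Arguments.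
Unset Strict Implicit.
Variable R : realType.
Implicit Types (c d e : R) (f g : R -> R) (p q : {poly R}).
Local Notation mu := (@lebesgue_measure R).

Lemma integrable_horner c d p : mu.-integrable `[c, d] (EFin \o horner p).
Proof.
apply: continuous_compact_integrable; first exact: segment_compact.
by apply: continuous_subspaceT => x; exact: continuous_horner.
Qed.

(** The values of [f] at [c] and [d] are arbitrary, but two points form a null set and do not affect
    measurability, so integrability passes from the open cell to the closed one. *)
Lemma integrable_eq_on_cell c d f p : (forall x, c < x < d -> f x = p.[x]) ->
  mu.-integrable `[c, d] (EFin \o f).
Proof.
move=> fp.
have : mu.-integrable `]c, d[ (EFin \o f).
  apply: (@eq_integrable _ _ _ mu `]c, d[ (measurable_itv _) (EFin \o horner p)
    (EFin \o f)).
    by move=> x; rewrite inE/= in_itv/= => /fp ->.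
  by apply: (integrableS _ _ _ (integrable_horner c d p)) => //;
    exact: subset_itv_oo_cc.
case/integrableP => /measurable_EFinP mf fi; apply/integrableP; split.
  by apply/measurable_EFinP; exact: measurable_fun_itv_cc mf.
rewrite integral_itv_bndoo//.
by apply: measurableT_comp => //; exact/measurable_EFinP.
Qed.

Lemma Rintegral_eq_on_cell c d f p : (forall x, c < x < d -> f x = p.[x]) ->
  \int[mu]_(x in `[c, d]) f x = \int[mu]_(x in `[c, d]) p.[x].
Proof.
move=> fp; have If := integrable_eq_on_cell fp.
have Ip := integrable_horner c d p.
have sub g : mu.-integrable `[c, d] (EFin \o g) ->
    \int[mu]_(x in `[c, d]) g x = \int[mu]_(x in `]c, d[) g x.
  move=> Ig; rewrite -Rintegral_itv_bndo_bndc; last first.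
    by apply: (integrableS _ _ _ Ig) => //; exact: subset_itv_co_cc.
  rewrite -Rintegral_itv_obnd_cbnd//.
  by apply: (integrableS _ _ _ Ig) => //; exact: subset_itv_oo_cc.
rewrite !sub//; apply: eq_Rintegral => x.
by rewrite inE/= in_itv/= => /fp.
Qed.

Lemma integrable_itv_cat c e d f : c <= e -> e <= d ->
  mu.-integrable `[c, e] (EFin \o f) -> mu.-integrable `[e, d] (EFin \o f) ->
  mu.-integrable `[c, d] (EFin \o f).
Proof.
move=> ce ed Ic Id.
(* Dropping [e] from the right piece makes the two pieces disjoint, so the integral of the norm is
   additive over their union. *)
have {Id}Id : mu.-integrable `]e, d] (EFin \o f).
  by apply: (integrableS _ _ _ Id) => //; exact: subset_itv_oc_cc.
rewrite (@itv_bndbnd_setU _ _ (BLeft c) (BRight e) (BRight d)) ?bnd_simp//.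
case/integrableP: Ic => mc ic; case/integrableP: Id => md id.
have mf : measurable_fun (`[c, e] `|` `]e, d]) (EFin \o f).
  exact/measurable_funU.
apply/integrableP; split => //.
rewrite ge0_integral_setU//; first exact: lte_add_pinfty.
  exact: measurableT_comp.
apply/disj_setPS => x /= [].
by rewrite !in_itv/= => /andP[_ xe] /andP[/lt_le_trans/(_ xe)]; rewrite ltxx.
Qed.

Lemma Rintegral_itv_cat c e d f : c <= e -> e <= d ->
  mu.-integrable `[c, d] (EFin \o f) ->
  \int[mu]_(x in `[c, d]) f x
    = \int[mu]_(x in `[c, e]) f x + \int[mu]_(x in `[e, d]) f x.
Proof.
move=> ce ed If; apply/eqP; rewrite addrC -subr_eq; apply/eqP.
rewrite Rintegral_itvB ?bnd_simp//.
rewrite Rintegral_itv_obnd_cbnd//; apply: (integrableS _ _ _ If) => //.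
by apply: subset_itv; rewrite bnd_simp.
Qed.

Lemma Rintegral_horner_lin c d (I : finType) (z : I -> R) (p : I -> {poly R}) :
  \int[mu]_(x in `[c, d]) (\sum_i z i *: p i).[x]
    = \sum_i z i * \int[mu]_(x in `[c, d]) (p i).[x].
Proof.
apply: (big_ind2 (fun q y => \int[mu]_(x in `[c, d]) q.[x] = y)).
- by rewrite -[RHS](mul0r (\int[mu]_(x in `[c, d]) (0 : {poly R}).[x]))
    -RintegralZl ?integrable_horner//; apply: eq_Rintegral => x _;
    rewrite horner0 mul0r.
- move=> q1 _ q2 _ <- <-.
  rewrite -RintegralD//; [|exact: integrable_horner..].
  by apply: eq_Rintegral => x _; rewrite hornerD.
- move=> i _; rewrite -RintegralZl//; last exact: integrable_horner.
  by apply: eq_Rintegral => x _; rewrite hornerZ.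
Qed.

(** Once distributed, the product is a linear combination indexed by pairs, to which
    [Rintegral_horner_lin] applies; the integrals of [p i * p j] are the entries of a Gram
    matrix. *)
Lemma Rintegral_horner_bilin c d (I : finType) (y z : I -> R)
    (p : I -> {poly R}) :
  \int[mu]_(x in `[c, d]) ((\sum_i y i *: p i) * (\sum_i z i *: p i)).[x]
    = \sum_i \sum_j y i * z j * \int[mu]_(x in `[c, d]) (p i * p j).[x].
Proof.
rewrite big_distrlr/= pair_big/= [RHS]pair_big/= -Rintegral_horner_lin.
apply: eq_Rintegral => x _; congr (_.[_]); apply: eq_bigr => ij _.
by rewrite -scalerAl -scalerAr scalerA.
Qed.

(** * Time derivative of the energy *)

Lemma is_derive_sum_fun n (h : 'I_n -> R -> R) (dh : 'I_n -> R) (t : R) :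
  (forall i, is_derive t 1 (h i) (dh i)) ->
  is_derive t 1 (fun r => \sum_(i < n) h i r) (\sum_(i < n) dh i).
Proof.
move=> hdh.
have -> : (fun r => \sum_(i < n) h i r) = \sum_(i < n) h i.
  by apply/funext => r; rewrite fct_sumE.
exact: is_derive_sum.
Qed.

Lemma is_derive_mulr (f : R -> R) (df m t : R) :
  is_derive t 1 f df -> is_derive t 1 (fun r => f r * m) (df * m).
Proof.
move=> fdf; apply: (@is_derive_eq _ _ _ _ _ _ _ _
  (is_deriveM fdf (is_derive_cst m t 1))).
by rewrite scaler0 add0r mulrC.
Qed.

(** Integrability is part of the conclusion because the integral of the time derivative against
    [v t] is later split along the cells. *)
Lemma is_derive_energy_cell (k : nat) c d (J : set R) (v : R -> R -> R) (t : R) :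
  c < d -> open J -> J t ->
  (forall r, J r -> exists p : {poly R}, (size p <= k.+1)%N /\
     forall x, c < x < d -> v r x = p.[x]) ->
  (forall x, c < x < d -> derivable (fun r => v r x) t 1) ->
  mu.-integrable `[c, d]
    (EFin \o (fun x => derive1 (fun r => v r x) t * v t x)) /\
  is_derive t 1 (fun r => \int[mu]_(x in `[c, d]) (v r x ^+ 2))
    (2 * \int[mu]_(x in `[c, d]) (derive1 (fun r => v r x) t * v t x)).
Proof.
move=> cd oJ Jt vpoly vder.
have nJ : \forall r \near t, J r by exact: open_nbhs_nbhs.
(* The denominators start at 2, which keeps all points strictly between [c] and [d]; the sequence is
   injective on the whole of [nat], as Lagrange interpolation asks. *)
pose y (i : nat) := c + (d - c) / i.+2%:R.
have ycd i : c < y i < d.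
  have i2 : 1 < i.+2%:R :> R by rewrite ltr1n.
  have dc : 0 < d - c by rewrite subr_gt0.
  rewrite /y ltrDl divr_gt0 ?ltr0n//= -ltrBrDl ltr_pdivrMr ?ltr0n//.
  by rewrite ltr_pMr.
have yinj : injective y.
  have dc0 : d - c != 0 by rewrite subr_eq0 gt_eqF.
  by move=> i j /addrI/(mulfI dc0)/invr_inj/eqP; rewrite eqr_nat => /eqP[].
pose L (i : 'I_k.+1) : {poly R} := tnth (k.+1.-lagrange y) i.
have vE r x : J r -> c < x < d -> v r x = (\sum_(i < k.+1) v r (y i) *: L i).[x].
  move=> /vpoly[p [sp vp]] cxd; rewrite vp//.
  rewrite [in LHS](lagrange_gen (ltn0Sn k) yinj sp); congr (_.[_]).
  by apply: eq_bigr => i _; rewrite vp// mul_polyC.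
pose dv (i : 'I_k.+1) : R := derive1 (fun r => v r (y i)) t.
have dvP (i : 'I_k.+1) : is_derive t 1 (fun r => v r (y i)) (dv i).
  by rewrite /dv derive1E; apply: derivableP; exact: vder.
have dvE x : c < x < d ->
    derive1 (fun r => v r x) t = (\sum_(i < k.+1) dv i *: L i).[x].
  move=> cxd; rewrite derive1E.
  apply: (@derive_val _ _ _ _ _ _ _).
  (* Interpolation holds for [r] in the open set [J], hence near [t], so it may be differentiated in
     time with [x] fixed. *)
  apply: (@near_eq_is_derive _ _ _
    (fun r => \sum_(i < k.+1) v r (y i) * (L i).[x])).
    near=> r; rewrite vE//; last by near: r.
    by rewrite horner_sum; apply: eq_bigr => i _; rewrite hornerZ.
  rewrite horner_sum; under eq_bigr do rewrite hornerZ.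
  by apply: is_derive_sum_fun => i; exact: is_derive_mulr.
have dvvE x : c < x < d -> derive1 (fun r => v r x) t * v t x
    = ((\sum_(i < k.+1) dv i *: L i) * (\sum_(i < k.+1) v t (y i) *: L i)).[x].
  by move=> cxd; rewrite hornerM -dvE// -vE.
split; first exact: integrable_eq_on_cell dvvE.
rewrite (Rintegral_eq_on_cell dvvE) Rintegral_horner_bilin.
pose M (i j : 'I_k.+1) := \int[mu]_(x in `[c, d]) (L i * L j).[x].
apply: (@near_eq_is_derive _ _ _ (fun r =>
  \sum_(i < k.+1) \sum_(j < k.+1) v r (y i) * v r (y j) * M i j)).
  near=> r; rewrite -Rintegral_horner_bilin.
  apply/esym/Rintegral_eq_on_cell => x cxd.
  by rewrite hornerM -vE ?expr2//; near: r.
(* The product rule yields two double sums; they coincide after exchanging [i] and [j], as [M] is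
   symmetric, whence the factor 2. *)
have -> : 2 * (\sum_(i < k.+1) \sum_(j < k.+1) dv i * v t (y j) * M i j)
    = \sum_(i < k.+1) \sum_(j < k.+1) (v t (y i) * dv j + v t (y j) * dv i) * M i j.
  under [RHS]eq_bigr do under eq_bigr do rewrite mulrDl.
  under [RHS]eq_bigr do rewrite big_split/=.
  rewrite big_split/= [X in X + _]exchange_big/= mulr_natl mulr2n.
  congr (_ + _); apply: eq_bigr => i _; apply: eq_bigr => j _.
    by rewrite /M [L j * L i]mulrC [v t _ * _]mulrC.
  by rewrite [v t _ * _]mulrC.
apply: is_derive_sum_fun => i; apply: is_derive_sum_fun => j.
by apply: is_derive_mulr; exact: is_deriveM.
Unshelve. all: by end_near. Qed.

Lemma is_derive_energy (k : nat) (a b : R) (s : seq R) (J : set R)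
    (v : R -> R -> R) (t : R) :
  itv_partition a b s -> open J -> J t ->
  (forall r, J r -> mu.-integrable `[a, b] (fun x => (v r x ^+ 2)%:E)) ->
  (forall r, J r -> forall j, (1 <= j <= size s)%N ->
     exists p : {poly R}, (size p <= k.+1)%N /\
       forall x, node a s j.-1 < x < node a s j -> v r x = p.[x]) ->
  (forall j x, (1 <= j <= size s)%N -> node a s j.-1 < x < node a s j ->
     derivable (fun r => v r x) t 1) ->
  mu.-integrable `[a, b]
    (EFin \o (fun x => derive1 (fun r => v r x) t * v t x)) /\
  is_derive t 1 (fun r => \int[mu]_(x in `[a, b]) (v r x ^+ 2))
    (2 * \int[mu]_(x in `[a, b]) (derive1 (fun r => v r x) t * v t x)).
Proof.
move=> + oJ Jt; elim: s a => [|e s IH] a.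
  (* The empty mesh forces [a = b]: the open cell is empty, and integrals over one point vanish. *)
  move=> /itv_partition_nil <- _ _ _; split.
    by apply: (@integrable_eq_on_cell _ _ _ 0) => x /andP[/lt_trans/[apply]]; rewrite ltxx.
  rewrite set_itv1 Rintegral_set1 mulr0.
  rewrite (_ : (fun _ => _) = cst 0); first exact: is_derive_cst.
  by apply/funext => r; rewrite Rintegral_set1.
move=> part Iv vpoly vder.
have ae : a < e by case: part => /= /andP[].
have partS := itv_partition_cons part.
have eb := itv_partition_le partS.
have [Ic Dc] := is_derive_energy_cell ae oJ Jt
  (fun r Jr => vpoly r Jr 1%N isT) (fun x => vder 1%N x isT).
have sub : `[e, b] `<=` `[a, b].
  by apply: subset_itv; rewrite bnd_simp// ltW.
(* Cell [j.+1] of the tail is cell [j.+2] of the full mesh; index 0 is excluded by [1 <= j]. *)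
have [r Jr|r Jr [//|j]|[//|j] x|Is Ds] := IH e partS.
- by apply: (@integrableS _ _ _ mu `[a, b] `[e, b]) => //; exact: Iv.
- exact: (vpoly r Jr j.+2).
- exact: (vder j.+2).
have Ie : mu.-integrable `[a, b]
    (EFin \o (fun x => derive1 (fun r => v r x) t * v t x)).
  exact: integrable_itv_cat (ltW ae) eb Ic Is.
split=> //.
rewrite (Rintegral_itv_cat (ltW ae) eb Ie) mulrDr.
(* The energy splits at [e] only for [r] in [J], where the square is known to be integrable; this is
   enough near [t]. *)
apply: near_eq_is_derive (is_deriveD Dc Ds).
near=> r; apply/esym/(Rintegral_itv_cat (ltW ae) eb)/Iv.
by near: r; exact: open_nbhs_nbhs.
Unshelve. all: by end_near. Qed.
End piecewise_polynomial.

Theorem theorem2p1 (R : realType) (a b : R) (s : seq R) (k : nat)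
    (J : set R) (u q : R -> R -> R)
    (hab : a < b) (hs : itv_partition a b s) (hJ : open J)
    (huq : DG_solution a b s k J u q) (t : R) (ht : J t) :
  let mu := @lebesgue_measure R in
  [/\ derivable (fun r => \int[mu]_(x in `[a, b]) (u r x ^+ 2)) t 1,
      2^-1 * derive1 (fun r => \int[mu]_(x in `[a, b]) (u r x ^+ 2)) t
        = - (\int[mu]_(x in `[a, b]) (q t x ^+ 2))
    & - (\int[mu]_(x in `[a, b]) (q t x ^+ 2)) <= 0].
Proof.
move=> mu.
have [|||_ dE] := @is_derive_energy R k a b s J u t hs hJ ht.
- by move=> r /huq[[[[]]]].
- by move=> r /huq[[[]]].
- by have [_] := huq t ht.
have [[Vu Vq] _ evol def_q] := huq t ht.
have {evol}evol := evol _ Vu; have {def_q}def_q := def_q _ Vq.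
(* Both equations now involve the same number [DG_form a s (u t) (q t)], with opposite signs. *)
rewrite /inner DG_formC in evol; rewrite /inner in def_q.
have qq : \int[mu]_(x in `[a, b]) (q t x ^+ 2) = DG_form a s (u t) (q t).
  by rewrite -def_q; apply: eq_Rintegral => x _; rewrite expr2.
split; first exact: ex_derive.
- by rewrite derive1E derive_val mulKf ?pnatr_eq0// evol qq.
- by rewrite oppr_le0; apply: Rintegral_ge0 => x _; exact: sqr_ge0.
Qed.
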